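(* Let $m>1$, let $p=(p_1,\dots,p_m)\in\{0,1\}^m$ be a binary vector whose zeros are located exactly at the positions $i_1<i_2<\dots<i_r$, with $i_r=m$, and let $\mathcal P=(p)^*=(p_1,p_2,p_3,\dots)$ be the infinite periodic up-down sequence with period $p$, so $p_{i+m}=p_i$ for all $i\ge 1$. Then the exponential generating function of the signed periodic de Bruijn triangle corresponding to $\mathcal P$, $$F^{\mathcal P}(x,y)=\sum_{i\ge 1}\sum_{j=1}^{i}\varepsilon_i\,\sharp^{\mathcal P}_{i,j}\,\frac{x^{i-j}y^{j-1}}{(i-j)!\,(j-1)!},$$ is given by $$F^{\mathcal P}(x,y)=e^{y}f^{\mathcal P}(x+y),\qquad f^{\mathcal P}(t)=\frac{\det\bar M^{\mathcal P}(t)}{\det M^{\mathcal P}(t)},$$ where $M^{\mathcal P}(t)$ and $\bar M^{\mathcal P}(t)$ are the $r\times r$ matrices $$M^{\mathcal P}(t)=\begin{pmatrix} \varphi_{m,0}&\varphi_{m,m-i_1}&\varphi_{m,m-i_2}&\cdots&\varphi_{m,m-i_{r-1}}\\ \varphi_{m,i_1}&\varphi_{m,0}&\varphi_{m,m+i_1-i_2}&\cdots&\varphi_{m,m+i_1-i_{r-1}}\\ \varphi_{m,i_2}&\varphi_{m,i_2-i_1}&\varphi_{m,0}&\cdots&\varphi_{m,m+i_2-i_{r-1}}\\ \vdots&\vdots&\vdots&\ddots&\vdots\\ \varphi_{m,i_{r-1}}&\varphi_{m,i_{r-1}-i_1}&\varphi_{m,i_{r-1}-i_2}&\cdots&\varphi_{m,0}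 \end{pmatrix}$$ and $$\bar M^{\mathcal P}(t)=\begin{pmatrix} 1&1&1&\cdots&1\\ \varphi_{m,i_1}&\varphi_{m,0}&\varphi_{m,m+i_1-i_2}&\cdots&\varphi_{m,m+i_1-i_{r-1}}\\ \varphi_{m,i_2}&\varphi_{m,i_2-i_1}&\varphi_{m,0}&\cdots&\varphi_{m,m+i_2-i_{r-1}}\\ \vdots&\vdots&\vdots&\ddots&\vdots\\ \varphi_{m,i_{r-1}}&\varphi_{m,i_{r-1}-i_1}&\varphi_{m,i_{r-1}-i_2}&\cdots&\varphi_{m,0} \end{pmatrix}$$ with $\varphi_{m,j}=\varphi_{m,j}(t)$.
   Context: The up-down sequence of a permutation $\sigma=(\sigma_1,\dots,\sigma_n)$ of $\{1,\dots,n\}$ is the binary vector of length $n-1$ whose $i$-th entry is $1$ if $\sigma_i<\sigma_{i+1}$ and $0$ otherwise. For an infinite binary sequence $\mathcal P=(p_1,p_2,\dots)$, $\sharp^{\mathcal P}_{i,j}$ ($1\le j\le i$) is the number of permutations of length $i$ whose up-down sequence is $(p_1,\dots,p_{i-1})$ and whose last entry equals $j$; in particular $\sharp^{\mathcal P}_{1,1}=1$. The triangular array $(\sharp^{\mathcal P}_{i,j})$ is the de Bruijn triangle of $\mathcal P$. The signed de Bruijn triangle is obtained by multiplying its $i$-th row by $\varepsilon_i=(-1)^{\bar p_1+\bar p_2+\dots+\bar p_{i-1}}$, where $\bar p_k=1-p_k$ (so $\varepsilon_1=1$). The Olivier functions of the $m$-th order are $\varphi_{m,i}(t)=\sum_{j=0}^{\infty}\frac{t^{jm+i}}{(jm+i)!}$,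 $0\le i\le m-1$. Setting $i_0=0$ and indexing rows and columns by $k,l\in\{0,\dots,r-1\}$, the $(k,l)$ entry of $M^{\mathcal P}(t)$ is $\varphi_{m,(i_k-i_l)\bmod m}(t)$ with the residue taken in $\{0,\dots,m-1\}$; $\bar M^{\mathcal P}(t)$ is obtained from $M^{\mathcal P}(t)$ by replacing the first row by ones. For $r=1$, $M^{\mathcal P}=(\varphi_{m,0})$ and $\bar M^{\mathcal P}=(1)$. Identities between generating functions are identities of formal power series. *)

(* Defs.v *)
From HB Require Import structures.
From mathcomp Require Import all_boot all_algebra all_fingroup boolp.

Set Implicit Arguments.
Unset Strict Implicit.
Unset Printing Implicit Defensive.

Import GRing.Theory.
Local Open Scope ring_scope.

(* [FPS a] is the series \sum_n a_n t^n; a series coerces to its sequence of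
   coefficients.  Bivariate series in x, y are iterated: in {fps {fps R}} the
   outer variable is y and the inner one is x, so the coefficient of
   x^a y^b in g is [g b a]. *)
Record fps (R : Type) := FPS { fps_coef :> nat -> R }.

Notation "{ 'fps' R }" := (fps R) (at level 0, format "{ 'fps'  R }").

HB.instance Definition _ (R : Type) := gen_eqMixin {fps R}.
HB.instance Definition _ (R : Type) := gen_choiceMixin {fps R}.

Lemma fpsP (R : Type) (f g : {fps R}) : (forall n, f n = g n) -> f = g.
Proof. by case: f g => [f] [g] fg; congr FPS; apply: funext. Qed.

Section Zmodule.
Variable R : zmodType.
Implicit Types f g h : {fps R}.

Definition fps_zero : {fps R} := FPS (fun _ => 0).
Definition fps_opp f : {fps R} := FPS (fun n => - f n).
Definition fps_add f g : {fps R} := FPS (fun n => f n + g n).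

Fact fps_addA : associative fps_add.
Proof. by move=> f g h; apply: fpsP => n; apply: addrA. Qed.
Fact fps_addC : commutative fps_add.
Proof. by move=> f g; apply: fpsP => n; apply: addrC. Qed.
Fact fps_add0 : left_id fps_zero fps_add.
Proof. by move=> f; apply: fpsP => n; apply: add0r. Qed.
Fact fps_addN : left_inverse fps_zero fps_opp fps_add.
Proof. by move=> f; apply: fpsP => n; apply: addNr. Qed.

HB.instance Definition _ :=
  GRing.isZmodule.Build {fps R} fps_addA fps_addC fps_add0 fps_addN.

End Zmodule.

Section Ring.
Variable R : comNzRingType.
Implicit Types f g h : {fps R}.

Definition fpsC (c : R) : {fps R} := FPS (fun n => if n == 0%N then c else 0).
Definition fpsX : {fps R} := FPS (fun n => (n == 1%N)%:R).
Definition fps_mul f g : {fps R} :=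
  FPS (fun n => \sum_(i < n.+1) f i * g (n - i)%N).

Let trunc n f : {poly R} := \poly_(i < n) f i.

Let fps_mulE n k f g :
  (k < n)%N -> fps_mul f g k = (trunc n f * trunc n g)`_k.
Proof.
move=> lt_kn; rewrite coefM; apply: eq_bigr => i _ /=.
by rewrite !coef_poly !(leq_ltn_trans _ lt_kn) ?leq_subr // -ltnS.
Qed.

Fact fps_mulC : commutative fps_mul.
Proof. by move=> f g; apply: fpsP => n; rewrite !(fps_mulE _ _ (ltnSn n)) mulrC. Qed.

Fact fps_mulA : associative fps_mul.
Proof.
move=> f g h; apply: fpsP => n; rewrite !(fps_mulE _ _ (ltnSn n)).
have le_ord (i : 'I_n.+1) : (n - i < n.+1)%N by rewrite ltnS leq_subr.
transitivity ((trunc n.+1 f * (trunc n.+1 g * trunc n.+1 h))`_n).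
  rewrite !coefM; apply: eq_bigr => i _; congr (_ * _).
  by rewrite coef_poly le_ord; apply: fps_mulE.
rewrite mulrA !coefM; apply: eq_bigr => i _; congr (_ * _).
by rewrite [RHS]coef_poly ltn_ord; apply/esym/fps_mulE.
Qed.

Fact fps_mul1 : left_id (fpsC 1) fps_mul.
Proof.
move=> f; apply: fpsP => n /=.
by rewrite big_ord_recl /= mul1r subn0 big1 ?addr0 // => i _; rewrite mul0r.
Qed.

Fact fps_mulD : left_distributive fps_mul +%R.
Proof.
move=> f g h; apply: fpsP => n /=.
by rewrite -big_split; apply: eq_bigr => i _; rewrite mulrDl.
Qed.

Fact fps_one_neq0 : fpsC 1 != 0.
Proof.
by apply/eqP => /(congr1 (fun f : {fps R} => f 0%N)) /eqP; rewrite oner_eq0.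
Qed.

HB.instance Definition _ := GRing.Zmodule_isComNzRing.Build {fps R}
  fps_mulA fps_mulC fps_mul1 fps_mulD fps_one_neq0.

End Ring.

Section UnitRing.
Variable R : comUnitRingType.
Implicit Types f g : {fps R}.

Definition fps_unit : {pred {fps R}} := [pred f : {fps R} | f 0%N \is a GRing.unit].

(* The first n coefficients of 1/f, by the usual recursion. *)
Fixpoint fps_inv_seq f n : seq R :=
  if n is k.+1 then
    let s := fps_inv_seq f k in
    rcons s ((f 0%N)^-1 * ((k == 0%N)%:R - \sum_(i < k) s`_i * f (k - i)%N))
  else [::].

(* Series that are not invertible are left unchanged, as for [GRing.inv]. *)
Definition fps_inv f : {fps R} :=
  if f \in fps_unit then FPS (fun n => (fps_inv_seq f n.+1)`_n) else f.

Let size_inv_seq f n : size (fps_inv_seq f n) = n.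
Proof. by elim: n => //= n IHn; rewrite size_rcons IHn. Qed.

Let nth_inv_seq f n k :
  (k < n)%N -> (fps_inv_seq f n)`_k = (fps_inv_seq f k.+1)`_k.
Proof.
elim: n => // n IHn; rewrite ltnS leq_eqVlt => /predU1P[-> // | lt_kn].
by rewrite {1}/fps_inv_seq -/fps_inv_seq nth_rcons size_inv_seq lt_kn IHn.
Qed.

Fact fps_mulVx : {in fps_unit, left_inverse (1 : {fps R}) fps_inv *%R}.
Proof.
move=> f Uf; apply: fpsP => n; rewrite /fps_inv Uf.
transitivity (\sum_(i < n) (fps_inv_seq f n)`_i * f (n - i)%N
              + (fps_inv_seq f n.+1)`_n * f 0%N).
  rewrite [LHS]big_ord_recr subnn; congr (_ + _).
  by apply: eq_bigr => i _; rewrite nth_inv_seq.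
rewrite [X in _ + X]/= nth_rcons size_inv_seq ltnn eqxx mulrAC mulVr // mul1r.
by rewrite addrC subrK; case: n.
Qed.

Fact fps_unitPl f g : g * f = 1 -> fps_unit f.
Proof.
move=> /(congr1 (fun h : {fps R} => h 0%N)).
rewrite /= big_ord1 subn0 => gf1.
by apply/unitrPr; exists (g 0%N); rewrite mulrC.
Qed.

Fact fps_inv_out : {in [predC fps_unit], fps_inv =1 id}.
Proof. by move=> f /negbTE nUf; rewrite /fps_inv nUf. Qed.

HB.instance Definition _ := GRing.ComNzRing_hasMulInverse.Build {fps R}
  fps_mulVx fps_unitPl fps_inv_out.

End UnitRing.

(* Substitution f(g) = \sum_n f_n g^n of a bivariate series g into a univariate
   series f.  It is meaningful when g has no constant term: then g^n has no term
   of total degree < n, so only n <= a + b contribute to x^a y^b. *)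
Definition fps_subst2 (R : comNzRingType) (f : {fps R}) (g : {fps {fps R}}) :
    {fps {fps R}} :=
  FPS (fun b => FPS (fun a => \sum_(n < (a + b).+1) f n * (g ^+ n) b a)).

Definition varx : {fps {fps rat}} := fpsC (fpsX rat).
Definition vary : {fps {fps rat}} := fpsX {fps rat}.

Definition exp_fps : {fps rat} := FPS (fun n => (n`!%:R)^-1).

(* One-line notation (sigma_1, ..., sigma_n), with values in {1, ..., n}. *)
Definition perm_word (n : nat) (s : 'S_n) : seq nat :=
  [seq (s k : nat).+1 | k <- enum 'I_n].

Definition up_down (w : seq nat) : seq bool :=
  [seq (nth 0%N w k < nth 0%N w k.+1)%N | k <- iota 0 (size w).-1].

(* An infinite binary sequence (p_1, p_2, ...) is a function P : nat -> bool with
   p_k = P k for k >= 1; the value P 0 is never used. *)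

Definition sharp (P : nat -> bool) (i j : nat) : nat :=
  #|[set s : 'S_i | (up_down (perm_word s) == [seq P k | k <- iota 1 i.-1])
                    && (last 0%N (perm_word s) == j)]|.

Definition dB_sign (P : nat -> bool) (i : nat) : rat :=
  (-1) ^+ (\sum_(1 <= k < i) ~~ P k)%N.

(* The monomial x^a y^b occurs in
   \sum_(i >= 1) \sum_(1 <= j <= i)
      eps_i #_(i, j) x^(i - j) y^(j - 1) / ((i - j)! (j - 1)!)
   exactly for j = b + 1 and i = a + b + 1. *)
Definition dB_egf (P : nat -> bool) : {fps {fps rat}} :=
  FPS (fun b => FPS (fun a =>
    dB_sign P (a + b).+1 * (sharp P (a + b).+1 b.+1)%:R / (a`! * b`!)%:R)).

(* The sequence (p)^* : p_1, ..., p_m, p_1, ..., p_m, ... *)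
Definition periodic (m : nat) (p : m.-tuple bool) (k : nat) : bool :=
  nth false p (k.-1 %% m).

Definition olivier (m i : nat) : {fps rat} :=
  FPS (fun n => if (i <= n)%N && (m %| n - i)%N then (n`!%:R)^-1 else 0).

(* The positions i_1 < ... < i_r are the entries of z, and [nth 0 (0 :: z) k]
   is i_k with the convention i_0 = 0.  As i_l <= m, the natural number
   i_k + m - i_l is not truncated and is congruent to i_k - i_l modulo m. *)
Definition dB_mx (m r : nat) (z : r.-tuple nat) : 'M[{fps rat}]_r :=
  let i_ k := nth 0%N (0%N :: z) k in
  \matrix_(k < r, l < r) olivier m ((i_ k + m - i_ l) %% m).

Definition dB_mx_bar (m r : nat) (z : r.-tuple nat) : 'M[{fps rat}]_r :=
  \matrix_(k < r, l < r) if k == 0%N :> nat then 1 else dB_mx m z k l.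

(* Main.v *)
(* The signed counts c(a, b) = eps_(a+b+1) #_(a+b+1, b+1) satisfy
   c(a, b+1) = c(a+1, b) + c(a, b) whatever the sequence is: the sign absorbs
   the difference between ascents and descents.  Hence F = e^y f(x + y) with
   f(t) = F(t, 0), and e^t f(t) = F(0, t).  A final ascent excludes the last
   entry 1 and a final descent excludes the largest last entry, so for n > 0
   the n-th coefficient of f vanishes if p_n = 1 and that of e^t f(t) vanishes
   if p_n = 0.  For periodic p, splitting f and e^t f(t) by exponents modulo m
   turns these conditions into the linear system M (f_l)_l = (1, 0, ..., 0)^T,
   where f_l collects the exponents congruent to i_l and f = \sum_l f_l, and
   Cramer's rule gives the quotient of determinants. *)

From HB Require Import structures.
Require Import Defs.
From mathcomp Require Import all_boot all_algebra all_fingroup zify ring.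

Import GRing.Theory Num.Theory.
Local Open Scope ring_scope.

(** * Up-down sequences under removal of the last entry *)

Lemma iotaSr (m n : nat) : iota m n.+1 = rcons (iota m n) (m + n)%N.
Proof. by rewrite -addn1 iotaD cats1. Qed.

Lemma up_down_rcons (w : seq nat) (x y : nat) :
  up_down (rcons (rcons w x) y) = rcons (up_down (rcons w x)) (x < y)%N.
Proof.
rewrite /up_down !size_rcons ![_.+1.-1]/= iotaSr map_rcons add0n; congr rcons.
- apply/eq_in_map => k; rewrite mem_iota add0n /= => lt_k.
  by rewrite !(nth_rcons 0%N (rcons w x)) !size_rcons !ltnS lt_k (ltnW lt_k).
- rewrite !(nth_rcons 0%N (rcons w x)) nth_rcons !size_rcons.
  by rewrite ltnn ltnSn !eqxx ltnn.
Qed.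

Lemma up_down_map (h : nat -> nat) (w : seq nat) :
  {mono h : x y / (x < y)%N} -> up_down (map h w) = up_down w.
Proof.
move=> h_mono; rewrite /up_down size_map; apply/eq_in_map=> k.
rewrite mem_iota add0n /= => lt_k; have lt_Sk : (k.+1 < size w)%N.
  by move: lt_k; case: (size w).
by rewrite !(nth_map 0%N) ?h_mono // ltnW.
Qed.

Lemma ltn_bump2 (h : nat) : {mono bump h : x y / (x < y)%N}.
Proof. by move=> x y; rewrite !ltnNge leq_bump2. Qed.

Lemma bump_lt (h x : nat) : (bump h x < h)%N = (x < h)%N.
Proof.
rewrite /bump; case: (leqP h x) => [le_hx | lt_xh]; last exact: lt_xh.
by apply/negbTE; rewrite -leqNgt leqW.
Qed.

Lemma size_perm_word (n : nat) (s : 'S_n) : size (perm_word s) = n.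
Proof. by rewrite size_map size_enum_ord. Qed.

(** Values of [t] from [j] on are pushed up by one to make room for [j] at the last position; words
    count values from 1, hence the shift to [j.+1]. *)
Lemma perm_word_lift (n : nat) (j : 'I_n.+1) (t : 'S_n) :
  perm_word (lift_perm ord_max j t) =
    rcons (map (bump j.+1) (perm_word t)) j.+1.
Proof.
rewrite /perm_word enum_ordSr map_rcons lift_perm_id; congr rcons.
rewrite -!map_comp; apply: eq_map => k /=.
have -> : widen_ord (leqnSn n) k = lift ord_max k.
  by apply: val_inj; rewrite [RHS]lift_max.
by rewrite lift_perm_lift /= bumpS.
Qed.

Lemma lift_perm_bij (n : nat) (i : 'I_n.+1) :
  bijective (fun u : 'I_n.+1 * 'S_n => lift_perm i u.1 u.2).
Proof.
apply: inj_card_bij => [[j s] [k t] /= eq_jk | ].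
  have def_k : j = k by rewrite -(lift_perm_id i j s) eq_jk lift_perm_id.
  rewrite -def_k in eq_jk *; congr pair; apply/permP=> x.
  by apply: (@lift_inj _ j); rewrite -!(lift_perm_lift i) eq_jk.
by rewrite card_prod !card_Sn card_ord factS.
Qed.

(** * Recurrences and boundary values of the counts *)

Definition up_down_perms (P : nat -> bool) (n : nat) : {set 'S_n} :=
  [set s : 'S_n | up_down (perm_word s) == [seq P k | k <- iota 1 n.-1]].

Lemma sharp_last (P : nat -> bool) (i j : nat) :
  sharp P i j = #|[set s in up_down_perms P i | last 0%N (perm_word s) == j]|.
Proof. by apply: eq_card => s; rewrite !inE. Qed.

(* Delete the last entry j + 1 and standardize the rest. *)
Lemma sharp_rec (P : nat -> bool) (n j : nat) : (j < n.+2)%N ->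
  sharp P n.+2 j.+1 =
    #|[set t in up_down_perms P n.+1
         | (last 0%N (perm_word t) <= j)%N == P n.+1]|.
Proof.
move=> lt_j; pose h (t : 'S_n.+1) := lift_perm ord_max (Ordinal lt_j) t.
have h_inj : injective h.
  move=> s t eq_st; have /bij_inj := lift_perm_bij _ (@ord_max n.+1).
  by move/(_ (_, s) (_, t) eq_st) => [].
rewrite sharp_last -(card_imset _ h_inj); apply: eq_card => s.
(* [bump j.+1] is strictly increasing, so it keeps the up-down sequence of the prefix; the new last
   comparison is an ascent iff the old last entry is at most [j]. *)
have wordh t : (h t \in up_down_perms P n.+2) =
    (t \in up_down_perms P n.+1) && ((last 0%N (perm_word t) <= j)%N == P n.+1).
  rewrite !inE /h perm_word_lift; have := size_perm_word _ t.
  case/lastP: (perm_word t) => // w x; rewrite size_rcons => -[size_w].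
  rewrite map_rcons up_down_rcons -map_rcons up_down_map; last exact: ltn_bump2.
  rewrite bump_lt last_rcons ltnS.
  by rewrite ![_.+1.-1]/= iotaSr map_rcons eqseq_rcons.
apply/idP/imsetP => [|[t tP ->]]; last first.
  apply/setIdP; move/setIdP/andP: tP; rewrite -wordh => ->.
  by rewrite perm_word_lift last_rcons /=.
case/setIdP=> sP last_s.
have [g gK hK] := lift_perm_bij _ (@ord_max n.+1).
case: (g s) (hK s) => k t /= def_s.
have def_k : k = Ordinal lt_j.
  apply: val_inj => /=; apply/eqP.
  by rewrite -eqSS -(eqP last_s) -def_s perm_word_lift last_rcons.
rewrite def_k in def_s.
by exists t => //; apply/setIdP/andP; rewrite -wordh /h def_s.
Qed.

(** After [sharp_rec], the conditions on the shorter permutation for two adjacent columns differ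
    exactly by the case where its last entry is [j.+1]. *)
Lemma sharp_step (P : nat -> bool) (n j : nat) : (j <= n)%N ->
  (if P n.+1 then sharp P n.+2 j.+2 = sharp P n.+2 j.+1 + sharp P n.+1 j.+1
   else sharp P n.+2 j.+1 = sharp P n.+2 j.+2 + sharp P n.+1 j.+1)%N.
Proof.
move=> le_jn; rewrite !sharp_rec ?ltnS ?leqW // sharp_last.
move: (up_down_perms P n.+1) => A; case: (P n.+1).
all: rewrite -(cardsID [set t | last 0%N (perm_word t) == j.+1]
                       [set t in A | _ == _]).
all: rewrite addnC; congr (_ + _)%N; apply: eq_card => t; rewrite !inE.
all: by rewrite ?eqb_id ?eqbF_neg -?ltnNge; case: (t \in A) => //=; lia.
Qed.

Lemma last_perm_word_gt0 (n : nat) (s : 'S_n.+1) :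
  (0 < last 0%N (perm_word s))%N.
Proof. by rewrite /perm_word enum_ordSr map_rcons last_rcons. Qed.

Lemma last_perm_word_le (n : nat) (s : 'S_n.+1) :
  (last 0%N (perm_word s) <= n.+1)%N.
Proof. by rewrite /perm_word enum_ordSr map_rcons last_rcons. Qed.

Lemma sharp_first_up (P : nat -> bool) (n : nat) :
  P n.+1 -> sharp P n.+2 1 = 0%N.
Proof.
move=> Pn; rewrite sharp_rec // Pn; apply/eqP; rewrite cards_eq0.
by apply/eqP/setP=> t; rewrite !inE leqNgt last_perm_word_gt0 andbF.
Qed.

Lemma sharp_last_down (P : nat -> bool) (n : nat) :
  ~~ P n.+1 -> sharp P n.+2 n.+2 = 0%N.
Proof.
move=> /negbTE Pn; rewrite sharp_rec // Pn; apply/eqP; rewrite cards_eq0.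
by apply/eqP/setP=> t; rewrite !inE last_perm_word_le andbF.
Qed.

Lemma sharp11 (P : nat -> bool) : sharp P 1 1 = 1%N.
Proof.
rewrite sharp_last (_ : [set _ in _ | _] = [set: 'S_1]) ?cardsT ?card_Sn //.
apply/setP=> s; rewrite !inE /perm_word enum_ordSr map_rcons last_rcons.
have -> : enum 'I_0 = [::] by apply: size0nil; rewrite size_enum_ord.
by case: (s _) => [[|k]].
Qed.

(** * Signed counts, indexed by the exponents of x and y *)

Definition signed_sharp (P : nat -> bool) (a b : nat) : rat :=
  dB_sign P (a + b).+1 * (sharp P (a + b).+1 b.+1)%:R.

Lemma dB_egfE (P : nat -> bool) (a b : nat) :
  dB_egf P b a = signed_sharp P a b / (a`! * b`!)%:R.
Proof. by []. Qed.

Lemma signed_sharp_step (P : nat -> bool) (a b : nat) :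
  signed_sharp P a b.+1 = signed_sharp P a.+1 b + signed_sharp P a b.
Proof.
rewrite /signed_sharp addSn addnS.
have -> : dB_sign P (a + b).+2 = dB_sign P (a + b).+1 * (-1) ^+ ~~ P (a + b).+1.
  by rewrite /dB_sign big_nat_recr //= exprD.
have := sharp_step P _ _ (leq_addl a b); case: (P _) => ->.
  by rewrite mulr1 natrD mulrDr.
by rewrite natrD /=; ring.
Qed.

Lemma signed_sharp00 (P : nat -> bool) : signed_sharp P 0 0 = 1.
Proof. by rewrite /signed_sharp sharp11 /dB_sign big_geq // mulr1. Qed.

Lemma signed_sharp_up (P : nat -> bool) (n : nat) :
  P n.+1 -> signed_sharp P n.+1 0 = 0.
Proof.
by move=> Pn; rewrite /signed_sharp addn0 sharp_first_up ?mulr0.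
Qed.

Lemma signed_sharp_down (P : nat -> bool) (n : nat) :
  ~~ P n.+1 -> signed_sharp P 0 n.+1 = 0.
Proof.
by move=> Pn; rewrite /signed_sharp add0n sharp_last_down ?mulr0.
Qed.

(** With E the shift of [a], [signed_sharp_step] says that raising [b] by one applies 1 + E; this is
    the expansion of its [b]-th power. *)
Lemma signed_sharp_binomial (P : nat -> bool) (a b : nat) :
  signed_sharp P a b =
    \sum_(i < b.+1) signed_sharp P (a + (b - i)) 0 *+ 'C(b, i).
Proof.
elim: b a => [|b IHb] a; first by rewrite big_ord1 subn0 addn0 bin0.
rewrite signed_sharp_step 2!IHb [RHS]big_ord_recl bin0 subn0.
under [X in _ = _ + X]eq_bigr => i _ do rewrite /= binS mulrnDr subSS.
(* By Pascal's rule, the ['C(b, i)] half is the expansion at [a]; the other half with the split-off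
   term is the one at [a.+1], since its top binomial vanishes. *)
rewrite big_split /= addrA; congr (_ + _); rewrite big_ord_recl big_ord_recr /=.
rewrite bin0 subn0 addSnnS bin_small // mulr0n addr0; congr (_ + _).
by apply: eq_bigr => i _; rewrite addSnnS -subSn.
Qed.

(** * Coefficients of products, powers and substitutions *)

Lemma fps_mulE (R : comNzRingType) (f g : {fps R}) (n : nat) :
  (f * g) n = \sum_(i < n.+1) f i * g (n - i)%N.
Proof. by []. Qed.

Lemma fps_sumE (R : zmodType) (I : Type) (s : seq I) (Q : pred I)
    (F : I -> {fps R}) (n : nat) :
  (\sum_(i <- s | Q i) F i) n = \sum_(i <- s | Q i) F i n.
Proof. by apply: (big_morph (fun f : {fps R} => f n)). Qed.

Lemma fpsC_mulE (R : comNzRingType) (c : R) (f : {fps R}) (n : nat) :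
  (fpsC c * f) n = c * f n.
Proof.
rewrite fps_mulE big_ord_recl subn0 big1 ?addr0 // => i _.
by rewrite /= mul0r.
Qed.

Lemma fpsX_mulE (R : comNzRingType) (f : {fps R}) (n : nat) :
  (fpsX R * f) n = if n is k.+1 then f k else 0.
Proof.
rewrite fps_mulE big_ord_recl /= mul0r add0r; case: n => [|n].
  by rewrite big_ord0.
rewrite big_ord_recl /= mul1r subSS subn0 big1 ?addr0 // => i _.
by rewrite mul0r.
Qed.

Lemma fpsX_expE (R : comNzRingType) (n k : nat) :
  (fpsX R ^+ n) k = (k == n)%:R.
Proof.
elim: n k => [|n IHn] k; first by rewrite expr0 /=; case: k.
by rewrite exprS fpsX_mulE; case: k.
Qed.

Lemma varxDvary_expE (n b a : nat) :
  ((varx + vary) ^+ n) b a = 'C(n, b)%:R *+ (a + b == n)%N.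
Proof.
elim: n b a => [|n IHn] b a.
  by rewrite expr0 /=; case: b a => [|b] [|a]; rewrite // addnS.
rewrite exprS mulrDl.
have -> : (varx * (varx + vary) ^+ n + vary * (varx + vary) ^+ n) b a =
    (varx * (varx + vary) ^+ n) b a + (vary * (varx + vary) ^+ n) b a by [].
rewrite fpsC_mulE !fpsX_mulE; case: a => [|a]; case: b => [|b].
- by rewrite addr0.
- rewrite add0r IHn !add0n eqSS; case: eqP => // ->.
  by rewrite !binn.
- by rewrite addr0 IHn !addn0 eqSS !bin0.
- rewrite !IHn !addSn !addnS !eqSS binS natrD.
  by case: eqP; rewrite // addr0.
Qed.

Lemma exp_subst_varyE (b : nat) :
  fps_subst2 exp_fps vary b = fpsC (b`!%:R)^-1.
Proof.
apply: fpsP => a /=; under eq_bigr => n _ do rewrite fpsX_expE.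
have lt_b : (b < (a + b).+1)%N by rewrite ltnS leq_addl.
rewrite (bigD1 (Ordinal lt_b)) //= eqxx big1 ?addr0 => [|n ne_n].
  by case: a {lt_b} => [|a]; rewrite ?mulr1 ?mulr0.
by rewrite -val_eqE /= eq_sym in ne_n; rewrite (negbTE ne_n) mulr0.
Qed.

Lemma subst_varxDvaryE (f : {fps rat}) (b a : nat) :
  fps_subst2 f (varx + vary) b a = f (a + b)%N * 'C(a + b, b)%:R.
Proof.
rewrite /=; under eq_bigr => n _ do rewrite varxDvary_expE.
(* (x + y)^n is homogeneous of degree n, so only the last index n = a + b of the truncated sum
   contributes. *)
rewrite big_ord_recr /= eqxx big1 ?add0r // => n _.
by rewrite gtn_eqF ?ltn_ord // mulr0.
Qed.

(** * The factorization e^y f(x + y) *)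

Lemma dB_egf0E (P : nat -> bool) (n : nat) :
  dB_egf P 0%N n = signed_sharp P n 0 / n`!%:R.
Proof. by rewrite dB_egfE fact0 muln1. Qed.

Lemma exp_mul_substE (f : {fps rat}) (b a : nat) :
  (fps_subst2 exp_fps vary * fps_subst2 f (varx + vary)) b a =
    \sum_(i < b.+1)
      (i`!%:R)^-1 * (f (a + (b - i))%N * 'C(a + (b - i), b - i)%:R).
Proof.
move: (fps_subst2 exp_fps vary) (fps_subst2 f _) exp_subst_varyE
  (subst_varxDvaryE f) => g h gE hE.
rewrite fps_mulE fps_sumE; apply: eq_bigr => i _.
by rewrite gE fpsC_mulE hE.
Qed.

Lemma natr_fact_neq0 (n : nat) : n`!%:R != 0 :> rat.
Proof. by rewrite pnatr_eq0 -lt0n fact_gt0. Qed.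

Lemma bin_factV (n i : nat) : (i <= n)%N ->
  (i`!%:R)^-1 * ((n - i)`!%:R)^-1 = 'C(n, i)%:R / n`!%:R :> rat.
Proof.
move=> le_in; have nz := natr_fact_neq0.
have /(congr1 (fun k => k%:R : rat)) := bin_fact le_in.
rewrite !natrM => <-; set c := 'C(n, i)%:R.
have c_neq0 : c != 0 by rewrite pnatr_eq0 -lt0n bin_gt0.
by move: (nz i) (nz (n - i)%N) => ? ?; field; apply/and3P.
Qed.

Lemma dB_egf_factor (P : nat -> bool) :
  dB_egf P =
    fps_subst2 exp_fps vary * fps_subst2 (dB_egf P 0%N) (varx + vary).
Proof.
apply: fpsP => b; apply: fpsP => a.
rewrite exp_mul_substE dB_egfE signed_sharp_binomial mulr_suml.
apply: eq_bigr => i _; have le_ib : (i <= b)%N by rewrite -ltnS.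
rewrite dB_egf0E; set s := signed_sharp _ _ _; set k := (b - i)%N.
transitivity (s * (a`!%:R)^-1 * ('C(b, i)%:R / b`!%:R)).
  by rewrite natrM invfM -mulr_natr; ring.
(* Both sides carry 1 / (a! i! k!): [bin_factV] is used once for k in a + k and once for i in b. *)
have /bin_factV : (k <= a + k)%N by rewrite leq_addl.
rewrite -(bin_factV _ _ le_ib) addnK -/k => def_V.
transitivity ((i`!%:R)^-1 * s * ('C(a + k, k)%:R / (a + k)`!%:R)); last by ring.
by rewrite -def_V; ring.
Qed.

(** The case x = 0 of the factorization: e^t f(t) = F(0, t). *)
Lemma exp_mul_dB_egf0 (P : nat -> bool) (n : nat) :
  (exp_fps * dB_egf P 0%N) n = signed_sharp P 0 n / n`!%:R.
Proof.
rewrite fps_mulE signed_sharp_binomial mulr_suml.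
apply: eq_bigr => i _; have le_in : (i <= n)%N by rewrite -ltnS.
rewrite dB_egf0E add0n [exp_fps i]/= mulrCA (bin_factV _ _ le_in).
by rewrite mulrA mulr_natr.
Qed.

(** * Olivier functions and residue classes of exponents *)

Lemma olivierE (m d n : nat) : (d < m)%N ->
  olivier m d n = if (n %% m == d)%N then (n`!%:R)^-1 else 0.
Proof.
move=> lt_dm; congr (if _ then _ else _).
case: leqP => [le_dn | lt_nd] /=.
  by rewrite -eqn_mod_dvd // (modn_small lt_dm).
by rewrite modn_small ?(ltn_trans lt_nd) // ltn_eqF.
Qed.

Definition fps_class (m d : nat) (f : {fps rat}) : {fps rat} :=
  FPS (fun n => if (n %% m == d)%N then f n else 0).

Lemma fps_classE (m d n : nat) (f : {fps rat}) :
  fps_class m d f n = if (n %% m == d)%N then f n else 0.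
Proof. by []. Qed.

(** Exponents add: a product with an exponent in class d' lands in class d exactly when the
    exponential contributes an exponent in class d - d'. *)
Lemma olivier_mul_class (m d d' : nat) (f : {fps rat}) :
  (d < m)%N -> (d' < m)%N ->
  olivier m ((d + m - d') %% m) * fps_class m d' f =
    fps_class m d (exp_fps * fps_class m d' f).
Proof.
move=> lt_d lt_d'; have m_gt0 : (0 < m)%N by apply: leq_ltn_trans lt_d.
apply: fpsP => n; rewrite [RHS]fps_classE !fps_mulE.
transitivity (\sum_(i < n.+1) if (n %% m == d)%N
    then exp_fps i * fps_class m d' f (n - i)%N else 0); last first.
  by case: eqP => _ //; rewrite big1.
apply: eq_bigr => i _; rewrite olivierE ?ltn_pmod //=.
case: (eqVneq ((n - i) %% m)%N d') => [def_d' | _]; last first.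
  by rewrite !mulr0 if_same.
have -> : (n %% m == d)%N = (i %% m == (d + m - d') %% m)%N.
  rewrite -(eqn_modDr d') subnK; last by rewrite ltnW ?ltn_addl.
  rewrite -def_d' modnDmr subnKC; last by rewrite -ltnS.
  by rewrite modnDr (modn_small lt_d).
by case: eqP; rewrite ?mul0r.
Qed.

(** * Cramer's rule and constant terms of determinants *)

(** The two matrices differ only in row 0, so they share its cofactors; applying [\adj A] to the
    system gives [cofactor A 0 l = \det A * v l]. *)
Lemma det_first_row1 (R : comUnitRingType) (n : nat) (A : 'M[R]_n.+1)
    (v : 'I_n.+1 -> R) :
  (forall k, \sum_l A k l * v l = (k == 0)%:R) ->
  \det (\matrix_(k, l) if k == 0%N :> nat then 1 else A k l) =
    \det A * \sum_l v l.
Proof.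
move=> Av; set B := \matrix_(k, l) _.
rewrite (expand_det_row B 0) mulr_sumr; apply: eq_bigr => l _.
have -> : cofactor B 0 l = cofactor A 0 l.
  rewrite /cofactor; congr (_ * \det _); apply/matrixP=> i j.
  by rewrite !mxE.
rewrite mxE mul1r.
have /(congr1 (mulmx (\adj A))) : A *m (\col_l v l) = delta_mx 0 (0 : 'I_1).
  apply/matrixP=> k j; rewrite !mxE [j]ord1 eqxx andbT -Av.
  by apply: eq_bigr => x _; rewrite mxE.
rewrite mulmxA mul_adj_mx mul_scalar_mx => /matrixP/(_ l 0).
by rewrite -colE !mxE.
Qed.

(** Made a ring morphism below so that it commutes with determinants. *)
Definition fps_const {R : comNzRingType} (f : {fps R}) : R := f 0%N.

Fact fps_const_zmod (R : comNzRingType) : zmod_morphism (@fps_const R).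
Proof. by []. Qed.

Fact fps_const_monoid (R : comNzRingType) : monoid_morphism (@fps_const R).
Proof. by split=> // f g; rewrite /fps_const fps_mulE big_ord1. Qed.

HB.instance Definition _ (R : comNzRingType) :=
  GRing.isZmodMorphism.Build {fps R} R (@fps_const R) (fps_const_zmod R).
HB.instance Definition _ (R : comNzRingType) :=
  GRing.isMonoidMorphism.Build {fps R} R (@fps_const R) (fps_const_monoid R).

(** * The linear system of a periodic sequence *)

Section ZeroPositions.

Variables (m : nat) (p : m.-tuple bool) (r : nat) (z : r.+1.-tuple nat).
Hypotheses (m_gt1 : (1 < m)%N) (z_sorted : sorted ltn z).
Hypothesis z_zeros : forall k : nat,
  (k \in z) = (1 <= k <= m)%N && ~~ nth false p k.-1.
Hypothesis z_last : last 0%N z = m.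

Let e (l : nat) : nat := nth 0%N (0%N :: z) l.
Let f : {fps rat} := dB_egf (periodic p) 0%N.

Let m_gt0 : (0 < m)%N := ltnW m_gt1.

Let uniq_0z : uniq (0%N :: z).
Proof.
rewrite /= (sorted_uniq ltn_trans ltnn z_sorted) andbT.
by rewrite z_zeros.
Qed.

Let e_inj (k l : nat) : (k < r.+2)%N -> (l < r.+2)%N -> (e k == e l) = (k == l).
Proof. by move=> lt_k lt_l; rewrite nth_uniq //= size_tuple. Qed.

Let e_inj_ord (k l : 'I_r.+1) : (e k == e l) = (k == l).
Proof. by rewrite e_inj // ltnS ltnW. Qed.

Let e_last : e r.+1 = m.
Proof.
rewrite -z_last; have := nth_last 0%N (0%N :: z).
by rewrite [(size _).-1]/= size_tuple.
Qed.

Let e_lt (l : nat) : (l < r.+1)%N -> (e l < m)%N.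
Proof.
move=> lt_l; have : e l != e r.+1 by rewrite e_inj ?ltn_eqF // ltnW.
rewrite e_last ltn_neqAle => -> /=.
have : e l \in 0%N :: z by rewrite mem_nth //= size_tuple ltnW.
by rewrite inE z_zeros => /predU1P[-> //| /andP[/andP[]]].
Qed.

(** The last zero, at position m, has residue 0 and is represented by i_0 = 0; the other zeros are
    their own residues. *)
Let periodic_e (n : nat) :
  ~~ periodic p n.+1 = [exists l : 'I_r.+1, (n.+1 %% m)%N == e l].
Proof.
have lt_q : (n %% m < m)%N by rewrite ltn_pmod.
have -> : ~~ periodic p n.+1 = ((n %% m).+1 \in z) by rewrite z_zeros /= lt_q.
have -> : (n.+1 %% m = (n %% m).+1 %% m)%N.
  by rewrite -[in RHS]addn1 modnDml addn1.
move: (n %% m)%N lt_q => q; rewrite leq_eqVlt => /predU1P[-> | lt_q].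
  rewrite modnn; transitivity true.
    have := mem_last 0%N z; rewrite z_last inE => /predU1P[m0 | //].
    by have := m_gt0; rewrite m0.
  by apply/esym/existsP; exists ord0.
rewrite modn_small //; apply/idP/existsP => [q_in | []].
  have lt_j : (index q.+1 z < r.+1)%N.
    by rewrite -[X in (_ < X)%N](size_tuple z) index_mem.
  have e_j : e (index q.+1 z).+1 = q.+1 by rewrite /e /= nth_index.
  (* The index [r.+1] is excluded: its entry is m, while [q.+1 < m]. *)
  have lt_Sj : ((index q.+1 z).+1 < r.+1)%N.
    rewrite ltn_neqAle lt_j andbT; apply: contraTneq lt_q => eq_j.
    by rewrite -e_j eq_j e_last ltnn.
  by exists (Ordinal lt_Sj); rewrite /= e_j.
by move=> [[|l] lt_l] /eqP /= -> //; rewrite /e /= mem_nth // size_tuple ltnW.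
Qed.

(** The residues are distinct, so no exponent is counted twice; an exponent n outside all classes is
    positive with p_n = 1, where f has coefficient 0. *)
Let sum_class : \sum_(l < r.+1) fps_class m (e l) f = f.
Proof.
apply: fpsP => n; rewrite fps_sumE.
under eq_bigr => l _ do rewrite fps_classE.
have [l /eqP e_l | no_l] := pickP (fun l : 'I_r.+1 => (n %% m)%N == e l).
  rewrite (bigD1 l) // e_l eqxx big1 => [|k]; first exact: addr0.
  by rewrite e_inj_ord eq_sym => /negbTE ->.
rewrite big1 => [|l _]; last by rewrite no_l.
case: n no_l => [/(_ ord0) | n no_l]; first by rewrite mod0n.
rewrite /f dB_egf0E signed_sharp_up ?mul0r //.
by apply: contraT; rewrite periodic_e => /existsP[l]; rewrite no_l.
Qed.

(** Row k gives the class-i_k part of e^t f(t). Positive exponents n there have p_n = 0, hence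
    coefficient 0; the constant term 1 lies in class i_0. *)
Let dB_mx_class (k : 'I_r.+1) :
  \sum_l dB_mx m z k l * fps_class m (e l) f = (k == 0)%:R.
Proof.
transitivity (fps_class m (e k) (exp_fps * f)).
  rewrite -[in RHS]sum_class mulr_sumr; apply: fpsP => n; rewrite fps_sumE.
  transitivity (\sum_l
      fps_class m (e k) (exp_fps * fps_class m (e (l : 'I_r.+1)) f) n).
    by apply: eq_bigr => l _; rewrite mxE olivier_mul_class ?e_lt.
  under eq_bigr => l _ do rewrite fps_classE.
  rewrite fps_classE fps_sumE.
  by case: eqP => _ //; rewrite big1.
apply: fpsP => n; rewrite fps_classE exp_mul_dB_egf0; case: n => [|n].
  rewrite mod0n (e_inj_ord ord0 k) signed_sharp00 divr1 eq_sym.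
  by case: (_ == _).
transitivity (0 : rat); last by case: (k == 0).
case: eqP => // e_k; rewrite signed_sharp_down ?mul0r // periodic_e.
by apply/existsP; exists k; apply/eqP.
Qed.

(** At t = 0 only [olivier m 0] is nonzero, with value 1, and the i_l are distinct modulo m: the
    matrix becomes the identity. *)
Lemma dB_mx_const : fps_const (\det (dB_mx m z)) = 1.
Proof.
rewrite -det_map_mx -[RHS](det1 _ r.+1); congr (\det _).
apply/matrixP=> k l; rewrite !mxE.
rewrite -[LHS]/(olivier m ((e k + m - e l) %% m) 0%N) olivierE ?ltn_pmod //.
rewrite invr1.
have -> : (0 == e k + m - e l %[mod m])%N = (k == l); last by case: eqP.
rewrite -(eqn_modDr (e l)) subnK ?(ltnW (ltn_addl _ (e_lt _ _))) //.
rewrite add0n modnDr.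
by rewrite !modn_small ?e_lt // e_inj_ord eq_sym.
Qed.

Lemma dB_egf0_det :
  \det (dB_mx m z) \is a GRing.unit /\
  f = \det (dB_mx_bar m z) / \det (dB_mx m z).
Proof.
have det_unit : \det (dB_mx m z) \is a GRing.unit.
  have : fps_const (\det (dB_mx m z)) \is a GRing.unit.
    by rewrite dB_mx_const unitr1.
  by [].
split=> //; rewrite [\det (dB_mx_bar m z)](det_first_row1 _ _ _ _ dB_mx_class).
by rewrite sum_class mulrC mulKr.
Qed.

End ZeroPositions.

Theorem theorem1 (m : nat) (p : m.-tuple bool) (r : nat) (z : r.-tuple nat)
    (m_gt1 : (1 < m)%N)
    (z_sorted : sorted ltn z)
    (z_zeros : forall k : nat,
       (k \in z) = (1 <= k <= m)%N && ~~ nth false p k.-1)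
    (z_last : last 0%N z = m) :
  \det (dB_mx m z) \is a GRing.unit /\
  dB_egf (periodic p) =
    fps_subst2 exp_fps vary *
    fps_subst2 (\det (dB_mx_bar m z) / \det (dB_mx m z)) (varx + vary).
Proof.
case: r => [|r] in z z_sorted z_zeros z_last *.
  (* With no zeros, [last] returns its default 0, which would be m. *)
  by rewrite tuple0 in z_last; rewrite -z_last in m_gt1.
have [det_unit def_f] := dB_egf0_det _ _ _ _ m_gt1 z_sorted z_zeros z_last.
by split=> //; rewrite dB_egf_factor def_f.
Qed.
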